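(* Let $U\subset\mathbb{R}^N$ be an open connected bounded set and let $u:\overline{U}\to\mathbb{R}^N$ be a continuous, locally Lipschitz, open map such that $\mathcal{L}^N(U)=\mathcal{L}^N(u(U))$ and (i) $u(\partial U)\subset\partial(u(U))$; (ii) $u$ is a.e. differentiable and $\nabla u\in O(N)$ a.e. on $U$. Then $u$ is an affine function.
   Context: $O(N)$ denotes the set of orthogonal $N\times N$ matrices. *)

(* Defs.v *)
From HB Require Import structures.
From mathcomp Require Import all_boot all_order all_algebra.
From mathcomp Require Import all_classical all_reals all_analysis.
Set Implicit Arguments. Unset Strict Implicit. Unset Printing Implicit Defensive.
Import Order.TTheory GRing.Theory Num.Theory.
Import numFieldNormedType.Exports.
Local Open Scope classical_set_scope.
Local Open Scope ring_scope.

Section Defs.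
Variables (R : realType) (N : nat).
Local Notation V := 'rV[R]_N.

Definition box (a b : V) : set V :=
  [set x | forall i : 'I_N, a ord0 i <= x ord0 i < b ord0 i].
Definition box_vol (a b : V) : R :=
  \prod_(i < N) Num.max 0 (b ord0 i - a ord0 i).

Definition lebesgue_outer (A : set V) : \bar R :=
  ereal_inf [set s : \bar R | exists (a b : nat -> V),
    A `<=` \bigcup_k box (a k) (b k) /\
    s = (\sum_(k <oo) (box_vol (a k) (b k))%:E)%E].

Definition lebesgue_null (A : set V) : Prop := lebesgue_outer A = 0%E.

Definition boundary (A : set V) : set V := closure A `\` interior A.

Definition bounded_set_rV (A : set V) : Prop :=
  exists M : R, forall x, A x -> `|x| <= M.

Definition locally_lipschitz_on (A : set V) (f : V -> V) : Prop :=
  forall x, A x -> exists r : R, 0 < r /\ exists k : R,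
    forall y z, A y -> A z -> `|y - x| < r -> `|z - x| < r ->
      `|f y - f z| <= k * `|y - z|.

Definition open_map_on (U : set V) (f : V -> V) : Prop :=
  forall W : set V, open W -> W `<=` U -> open (f @` W).

Definition orthogonal_mx (M : 'M[R]_N) : Prop := M *m M^T = 1%:M.

(* Jacobian: we use the library's derive.jacobian = lin1_mx ('d f x). *)

Definition affine_on (A : set V) (f : V -> V) : Prop :=
  exists (M : 'M[R]_N) (c : V), forall x, A x -> f x = x *m M + c.
End Defs.

(* Main.v *)
(** Off the null set the derivative is orthogonal, so the set of points where
    a difference quotient of [u] in a fixed direction [v] and at scale [1/k]
    exceeds [|v| + e] has measure tending to 0 with [1/k]; averaging over
    translates of a segment, [u] is locally 1-Lipschitz for the Euclidean norm.
    Such a map does not increase Lebesgue measure: if images of boxes grow by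
    a factor at most [c], then removing an inscribed Euclidean ball, whose
    image lies in a ball of the same radius, improves [c] to
    [c - (c - 1) * theta], and iterating brings [c] down to 1.  Since [U] and
    [u(U)] have the same measure, [u] cannot decrease the measure of open
    subsets of [U].  If [|u y - u z| < |y - z|], two disjoint balls of equal
    radius about [y] and [z] would be sent into balls that overlap, losing
    measure; so [u] is a local isometry, hence locally affine, hence affine by
    connectedness. *)

Require Import Defs.
From HB Require Import structures.
From mathcomp Require Import all_boot all_order all_algebra.
From mathcomp Require Import all_classical all_reals all_analysis.
From mathcomp Require Import measurable_realfun ring lra.
Import Order.TTheory GRing.Theory Num.Theory.
Import numFieldNormedType.Exports.
Local Open Scope classical_set_scope.
Local Open Scope ring_scope.

Set Implicit Arguments. Unset Strict Implicit. Unset Printing Implicit Defensive.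

(** * Lebesgue outer measure *)

Section OuterMeasure.
Variables (R : realType) (N : nat).
Local Notation V := 'rV[R]_N.
Local Notation mu := (@lebesgue_outer R N).
Implicit Types (a b x v : V) (A X : set V).

Lemma box_vol_ge0 a b : 0 <= box_vol a b.
Proof. by apply: prodr_ge0 => i _; rewrite le_max lexx. Qed.

Lemma lebesgue_outer_ge0 A : (0 <= mu A)%E.
Proof.
apply: le_ereal_inf_tmp => _ [a [b [_ ->]]].
by apply: nneseries_ge0 => k _ _; rewrite lee_fin box_vol_ge0.
Qed.

Lemma le_lebesgue_outer A X : A `<=` X -> (mu A <= mu X)%E.
Proof.
move=> AX; apply: ereal_inf_le_tmp => _ [a [b [Xab ->]]].
by exists a, b; split => //; exact: subset_trans AX Xab.
Qed.

Lemma lebesgue_outer_cover A (a b : nat -> V) :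
  A `<=` \bigcup_k box (a k) (b k) ->
  (mu A <= \sum_(k <oo) (box_vol (a k) (b k))%:E)%E.
Proof. by move=> Aab; apply: ereal_inf_lbound; exists a, b. Qed.

Lemma lebesgue_outer_adherent A (e : R) : mu A \is a fin_num -> 0 < e ->
  exists a b : nat -> V, A `<=` \bigcup_k box (a k) (b k) /\
    (\sum_(k <oo) (box_vol (a k) (b k))%:E <= mu A + e%:E)%E.
Proof.
move=> Afin e0; have [_ [a [b [Aab ->]]] h] := lb_ereal_inf_adherent e0 Afin.
by exists a, b; split => //; exact: ltW.
Qed.

(** Near-optimal covers of the [A n], with errors halving at each index, are merged into one cover.
    The case where some [A i] has infinite measure is trivial and is split off first. *)
Lemma lebesgue_outer_sigma_subadditive : sigma_subadditive mu.
Proof.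
move=> A; have [[i ioo]|] := pselect (exists i, mu (A i) = +oo%E).
  rewrite (eseries_pinfty _ _ ioo) ?leey// => n _.
  by rewrite -ltNye (lt_le_trans _ (lebesgue_outer_ge0 _)).
rewrite -forallNE => Aoo.
suff add2e (e : {posnum R}) :
    (mu (\bigcup_n A n) <= \sum_(i <oo) mu (A i) + e%:num%:E)%E.
  by apply/lee_addgt0Pr => _/posnumP[].
rewrite (le_trans _ (epsilon_trick _ _ _))//; last first.
  by move=> n; exact: lebesgue_outer_ge0.
have /choice[a /choice[b ab]] n : exists a b : nat -> V,
    A n `<=` \bigcup_k box (a k) (b k) /\
    (\sum_(k <oo) (box_vol (a k) (b k))%:E
       <= mu (A n) + (e%:num / (2 ^ n.+1)%:R)%:E)%E.
  apply: lebesgue_outer_adherent => //.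
  by rewrite ge0_fin_numE ?lebesgue_outer_ge0// ltey; apply/eqP/Aoo.
pose vol (ij : nat * nat) := (box_vol (a ij.1 ij.2) (b ij.1 ij.2))%:E.
have vol0 ij : (0 <= vol ij)%E by rewrite lee_fin box_vol_ge0.
(* A bijection between [nat] and [nat * nat] lists the double family of boxes; the unordered sum
   links this listing to the iterated series. *)
apply: (@le_trans _ _ (\esum_(i in setT) vol i)).
  have /card_esym/ppcard_eqP[f] := card_nat2.
  apply: le_trans (lebesgue_outer_cover (a := fun n => a (f n).1 (f n).2)
    (b := fun n => b (f n).1 (f n).2) _) _.
    move=> x [i _ /(ab i).1[j _ xij]]; exists (f^-1%FUN (i, j)) => //=.
    by rewrite invK ?inE.
  rewrite -(esum_pred_image vol f xpredT) ?[fun=> _]set_true//.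
  by rewrite image_eq.
rewrite (_ : esum _ _ = (\sum_(i <oo) \sum_(j <oo) vol (i, j))%E); last first.
  pose J : nat -> set (nat * nat) := fun i => [set (i, j) | j in setT].
  rewrite (_ : setT = \bigcup_k J k); last first.
    by rewrite predeqE => -[c d]; split => // _; exists c => //; exists d.
  rewrite esum_bigcupT //=; last first.
    apply/trivIsetP => i j _ _ ij.
    rewrite predeqE => -[n m] /=; split => //= -[] [_] _ [<-{n} _].
    by move=> [m' _] [] /esym/eqP; rewrite (negbTE ij).
  rewrite -(image_id [set: nat]) -fun_true esum_pred_image//; last first.
    by move=> n _; exact: esum_ge0.
  apply: eq_eseriesr => /= j _.
  rewrite -(esum_pred_image vol (pair j) predT)//=; last first.
    by move=> ? ? _ _; exact: (@can_inj _ _ _ snd).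
  by congr esum; rewrite predeqE => -[c d]; split; move=> [i _ <-]; exists i.
apply: lee_nneseries => [k _ _|k _]; last exact: (ab k).2.
by apply: nneseries_ge0 => m *; exact: vol0.
Qed.

End OuterMeasure.

(** * Consistency of the outer measure with the volume of boxes *)

Lemma nneseries_first (R : realType) (f : nat -> \bar R) :
  (forall k, f k.+1 = 0)%E -> (0 <= f 0%N)%E -> (\sum_(k <oo) f k = f 0%N)%E.
Proof.
move=> f0 f00; rewrite nneseries_recl//; last by case=> [//|k] _; rewrite f0.
by rewrite eseries_cond eseries0 ?adde0// => -[|k]//= _ _; rewrite f0.
Qed.

Section WeightedCover.
Variable R : realType.
Local Notation leb := (@lebesgue_measure R).

Definition indico (a b : R) (t : R) : R := \1_(`[a, b[%classic) t.

Lemma indico_ge0 a b t : 0 <= indico a b t.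
Proof. by rewrite /indico indicE. Qed.

Lemma measurable_indico a b : measurable_fun setT (indico a b).
Proof. exact: measurable_indic. Qed.

Lemma integral_indico a b :
  (\int[leb]_t (indico a b t)%:E = (Num.max 0 (b - a))%:E)%E.
Proof.
rewrite /indico integral_indic//= setIT lebesgue_measure_itv/= lte_fin.
case: ltP => ab; first by rewrite -EFinB max_r// subr_ge0 ltW.
by rewrite max_l// subr_le0.
Qed.

(* The weights make the induction on the dimension work: fixing one coordinate
   turns its indicators into new weights, and integrating them restores the
   missing side lengths. *)
Lemma weighted_cover n (a b : nat -> R) (A B : nat -> nat -> R) (c : R)
    (w : nat -> R) : 0 <= c -> (forall k, 0 <= w k) ->
  (forall x : nat -> R, ((c * \prod_(i < n) indico (a i) (b i) (x i))%:E <=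
     \sum_(k <oo) (w k * \prod_(i < n) indico (A k i) (B k i) (x i))%:E)%E) ->
  ((c * \prod_(i < n) Num.max 0 (b i - a i))%:E <=
     \sum_(k <oo) (w k * \prod_(i < n) Num.max 0 (B k i - A k i))%:E)%E.
Proof.
elim: n c w => [|n IH] c w c0 w0 h.
  move: (h (fun=> 0)); rewrite !big_ord0.
  under eq_eseriesr do rewrite big_ord0.
  by move=> {}h; under eq_eseriesr do rewrite big_ord0.
set P := \prod_(i < n) Num.max 0 (b i - a i).
pose Q k := \prod_(i < n) Num.max 0 (B k i - A k i).
have P0 : 0 <= P by apply: prodr_ge0 => i _; rewrite le_max lexx.
have Q0 k : 0 <= Q k by apply: prodr_ge0 => i _; rewrite le_max lexx.
have slice t : ((c * P * indico (a n) (b n) t)%:E <=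
    \sum_(k <oo) (w k * Q k * indico (A k n) (B k n) t)%:E)%E.
  rewrite mulrAC; under eq_eseriesr do rewrite mulrAC.
  apply: IH => [|k|x]; try by rewrite mulr_ge0// indico_ge0.
  have := h (fun i => if i == n then t else x i).
  rewrite big_ord_recr/= eqxx.
  under eq_bigr => i _ do rewrite ltn_eqF//.
  rewrite [X in c * X]mulrC [X in (X%:E <= _)%E -> _]mulrA.
  move=> /le_trans; apply.
  apply: lee_nneseries => k _.
    rewrite lee_fin mulr_ge0//; apply: prodr_ge0 => i _; exact: indico_ge0.
  rewrite big_ord_recr/= eqxx.
  under eq_bigr => i _ do rewrite ltn_eqF//.
  by rewrite mulrA mulrAC.
(* The last side length is the integral of its indicator on both sides, so the claim is [slice]
   integrated over [t], with series and integral exchanged by nonnegativity. *)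
rewrite big_ord_recr/= mulrA EFinM -integral_indico.
rewrite -ge0_integralZl_EFin//; last 3 first.
- by move=> t _; rewrite lee_fin indico_ge0.
- apply/measurable_EFinP; exact: measurable_indico.
- by rewrite mulr_ge0.
have -> : (\sum_(k <oo) (w k * \prod_(i < n.+1) Num.max 0 (B k i - A k i))%:E =
    \sum_(k <oo) \int[leb]_t (w k * Q k * indico (A k n) (B k n) t)%:E)%E.
  apply: eq_eseriesr => k _; under eq_integral do rewrite EFinM.
  rewrite ge0_integralZl_EFin//.
  - by rewrite integral_indico -EFinM big_ord_recr/= mulrA.
  - by move=> t _; rewrite lee_fin indico_ge0.
  - apply/measurable_EFinP; exact: measurable_indico.
  - by rewrite mulr_ge0.
have mQ k : measurable_fun setT
    (fun t => (w k * Q k * indico (A k n) (B k n) t)%:E).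
  by apply/measurable_EFinP; apply: measurable_funM => //; exact: measurable_indico.
have Qge0 k t : (0 <= (w k * Q k * indico (A k n) (B k n) t)%:E)%E.
  by rewrite lee_fin !mulr_ge0// indico_ge0.
rewrite -integral_nneseries//; apply: ge0_le_integral => //.
- by move=> t _; rewrite mule_ge0// lee_fin ?indico_ge0// mulr_ge0.
- apply: measurable_funeM; apply/measurable_EFinP; exact: measurable_indico.
- apply: (@ge0_emeasurable_sum _ _ _ _
    (fun k t => (w k * Q k * indico (A k n) (B k n) t)%:E) xpredT)
    => // k t _ _; exact: Qge0.
- by move=> t _; rewrite -EFinM; exact: slice.
Qed.

End WeightedCover.

(* In dimension 0 every box is the whole space and has volume 1, so that the
   empty set has infinite outer measure: hence the dimension [n.+1] below. *)
Section BoxMeasure.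
Variables (R : realType) (n : nat).
Local Notation V := 'rV[R]_n.+1.
Local Notation mu := (@lebesgue_outer R n.+1).
Implicit Types (a b x v : V) (A X : set V).

(** A cover cannot be cheaper than the box: the indicator of the box is pointwise at most the sum of
    the covering indicators, which is the hypothesis of [weighted_cover] with unit weights. *)
Lemma box_vol_cover a b (A B : nat -> V) :
  box a b `<=` \bigcup_k box (A k) (B k) ->
  ((box_vol a b)%:E <= \sum_(k <oo) (box_vol (A k) (B k))%:E)%E.
Proof.
move=> sub.
(* [weighted_cover] works with coordinates indexed by [nat], hence this reading of vectors as
   sequences. *)
pose co (x : V) (i : nat) := x ord0 (inord i).
have volE (x y : V) : box_vol x y =
    1 * \prod_(i < n.+1) Num.max 0 (co y i - co x i).
  by rewrite mul1r; apply: eq_bigr => i _; rewrite /co inord_val.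
rewrite volE; under eq_eseriesr do rewrite volE.
apply: (@weighted_cover R n.+1 (co a) (co b) (fun k => co (A k))
  (fun k => co (B k)) 1 (fun=> 1)) => // x.
have boxP y z : \prod_(i < n.+1) indico (co y i) (co z i) (x i) =
    ((\row_i x i) \in box y z)%:R :> R.
  have [/set_mem xb|/negP xb] := boolP (_ \in _).
    rewrite big1// => i _; rewrite /indico indicE mem_set//= in_itv/=.
    by have := xb i; rewrite mxE /co inord_val.
  have [i xi] : exists i : 'I_n.+1, ~ (y ord0 i <= x i < z ord0 i).
    apply/existsNP => h; apply: xb; apply/mem_set => i.
    by rewrite mxE; exact: h.
  rewrite (bigD1 i)//= /indico indicE memNset ?mul0r//=.
  by rewrite in_itv/= /co inord_val.
rewrite mul1r boxP; under eq_eseriesr do rewrite mul1r boxP.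
have [/set_mem/sub[k _ kx]|_] := boolP (_ \in box a b); last first.
  by apply: nneseries_ge0 => k _ _.
have /mem_set := kx => {}kx.
apply: le_trans (nneseries_lim_ge k.+1 _) => //.
rewrite big_mkord big_ord_recr/= kx/= leeDr//.
by apply: sume_ge0 => i _.
Qed.

Lemma box_empty (i : 'I_n.+1) a b : b ord0 i <= a ord0 i -> box a b = set0.
Proof.
move=> ab; apply/seteqP; split => // x /(_ i) /andP[ax xb].
by move: (lt_le_trans xb ab); rewrite ltNge ax.
Qed.

Lemma box_vol00 : box_vol (0 : V) 0 = 0.
Proof. by rewrite /box_vol big_ord_recl mxE subr0 maxxx mul0r. Qed.

Lemma lebesgue_outer_box a b : mu (box a b) = (box_vol a b)%:E.
Proof.
apply/eqP; rewrite eq_le; apply/andP; split; last first.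
  by apply: le_ereal_inf_tmp => _ [A [B [AB ->]]]; exact: box_vol_cover.
(* The box alone, padded by boxes with both corners 0, which have volume 0 in positive dimension. *)
pose f k : V := if k is 0%N then a else 0; pose g k : V := if k is 0%N then b else 0.
have -> : (box_vol a b)%:E = (\sum_(k <oo) (box_vol (f k) (g k))%:E)%E.
  rewrite nneseries_first//= ?lee_fin ?box_vol_ge0//.
  by move=> k; rewrite box_vol00.
by apply: lebesgue_outer_cover => x abx; exists 0%N.
Qed.

Lemma lebesgue_outer0 : mu set0 = 0%E.
Proof.
by rewrite -(@box_empty ord0 0 0)// lebesgue_outer_box box_vol00.
Qed.

HB.instance Definition _ := isOuterMeasure.Build R V mu lebesgue_outer0
  (@lebesgue_outer_ge0 R n.+1) (@le_lebesgue_outer R n.+1)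
  (@lebesgue_outer_sigma_subadditive R n.+1).

Lemma lebesgue_outer_shift A v : mu [set x + v | x in A] = mu A.
Proof.
suff le_shift (B : set V) (w : V) : (mu [set (x + w)%R | x in B] <= mu B)%E.
  apply/eqP; rewrite eq_le le_shift/=.
  apply: le_trans (le_shift _ (- v)); apply: le_lebesgue_outer => x Ax.
  by exists (x + v); rewrite ?addrK//; exists x.
apply: le_ereal_inf_tmp => _ [a [b [Bab ->]]].
have -> : (\sum_(k <oo) (box_vol (a k) (b k))%:E =
    \sum_(k <oo) (box_vol (a k + w) (b k + w))%:E)%E.
  apply: eq_eseriesr => k _; congr _%:E; apply: eq_bigr => i _.
  by rewrite !mxE; congr Num.max; ring.
apply: lebesgue_outer_cover => _ [x /Bab[k _ kx] <-]; exists k => // i.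
by rewrite !mxE lerD2r ltrD2r.
Qed.

End BoxMeasure.

(** * Carathéodory measurability of boxes and open sets *)

Section BoxMeasurable.
Variables (R : realType) (n : nat).
Local Notation V := 'rV[R]_n.+1.
Local Notation mu := (@lebesgue_outer R n.+1).
Implicit Types (a b x v : V) (A X : set V).

Definition set_coord x (i : 'I_n.+1) (c : R) : V :=
  \row_j if j == i then c else x ord0 j.

Lemma box_cut a b i c :
  box a b `&` [set x : V | x ord0 i < c] =
  box a (set_coord b i (Num.min (b ord0 i) c)).
Proof.
apply/seteqP; split => [x [abx /= xc] j|x abx].
  rewrite mxE; case: eqP => [->|_]; last exact: abx.
  by have /andP[-> xb] := abx i; rewrite lt_min xb.
have /andP[ax] := abx i; rewrite mxE eqxx lt_min => /andP[xb xc].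
split => // j; have := abx j; rewrite mxE.
by case: eqP => [-> _|//]; rewrite ax xb.
Qed.

Lemma box_cutC a b i c :
  box a b `&` ~` [set x : V | x ord0 i < c] =
  box (set_coord a i (Num.max (a ord0 i) c)) b.
Proof.
apply/seteqP; split => [x [abx /= /negP]|x abx].
  rewrite -leNgt => cx j; rewrite mxE.
  case: eqP => [->|_]; last exact: abx.
  by have /andP[ax ->] := abx i; rewrite ge_max ax cx.
have /andP[+ xb] := abx i; rewrite mxE eqxx ge_max => /andP[ax cx].
split; last by move=> /=; rewrite ltNge cx.
move=> j; have := abx j; rewrite mxE.
by case: eqP => [-> _|//]; rewrite ax xb.
Qed.

(** Clamping [c] by min and max keeps the identity true when the hyperplane misses the box and when
    the box is degenerate, so a whole cover can be cut without case distinction. *)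
Lemma box_vol_cut a b i c :
  box_vol a (set_coord b i (Num.min (b ord0 i) c)) +
  box_vol (set_coord a i (Num.max (a ord0 i) c)) b = box_vol a b.
Proof.
rewrite /box_vol (bigD1 i)//= [X in _ + X](bigD1 i)//= [RHS](bigD1 i)//=.
rewrite !mxE eqxx.
under eq_bigr => j ji do rewrite mxE (negbTE ji).
under [X in _ + _ * X]eq_bigr => j ji do rewrite mxE (negbTE ji).
rewrite -mulrDl; congr (_ * _).
set p := a ord0 i; set q := b ord0 i.
by have [] := leP q c; have [] := leP p c; have [] := leP p q;
  rewrite /Num.max; do ![case: ifP]; lra.
Qed.

(** Cutting each box of a near-optimal cover of [X] along the hyperplane covers both parts of [X] at
    the same total volume. *)
Lemma halfspace_caratheodory i c : mu.-caratheodory [set x : V | x ord0 i < c].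
Proof.
apply: le_caratheodory_measurable => X /=.
have [/eqP ->|Xoo] := boolP (mu X == +oo%E); first by rewrite leey.
have Xfin : mu X \is a fin_num by rewrite ge0_fin_numE ?ltey// outer_measure_ge0.
apply/lee_addgt0Pr => e e0.
have [a [b [Xab sum_le]]] := lebesgue_outer_adherent Xfin e0.
apply: le_trans sum_le.
under eq_eseriesr do rewrite -(box_vol_cut _ _ i c) EFinD.
rewrite nneseriesD; [|by move=> *; rewrite lee_fin box_vol_ge0..].
apply: leeD.
  apply: (lebesgue_outer_cover (a := a)
    (b := fun k => set_coord (b k) i (Num.min (b k ord0 i) c))).
  by move=> x [/Xab[k _ kx] xc]; exists k => //; rewrite -box_cut.
apply: (lebesgue_outer_cover (b := b)
  (a := fun k => set_coord (a k) i (Num.max (a k ord0 i) c))).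
by move=> x [/Xab[k _ kx] xc]; exists k => //; rewrite -box_cutC.
Qed.

Lemma box_caratheodory a b : mu.-caratheodory (box a b).
Proof.
pose C (i : 'I_n.+1) : set V :=
  [set x : V | x ord0 i < b ord0 i] `&` ~` [set x : V | x ord0 i < a ord0 i].
have -> : box a b = \big[setI/setT]_i C i.
  rewrite -bigcap_seq; apply/seteqP; split => [x abx i _|x abx i].
    by have /andP[ax xb] := abx i; split => //=; rewrite ltNge ax.
  have [|/= xb /negP] := abx i; first by rewrite /= mem_index_enum.
  by rewrite -leNgt => ->.
elim/big_ind : _ => [|A B mA mB|i _].
- rewrite -setC0; apply: caratheodory_measurable_setC.
  exact: caratheodory_measurable_set0.
- exact: caratheodory_measurable_setI.
- apply: caratheodory_measurable_setI; first exact: halfspace_caratheodory.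
  by apply: caratheodory_measurable_setC; exact: halfspace_caratheodory.
Qed.

Lemma coord_le_norm x i : `|x ord0 i| <= `|x|.
Proof.
by rewrite [leRHS]/Num.norm /= mx_normrE (le_bigmax _ _ (ord0, i)).
Qed.

Lemma norm_lt_coord x r : 0 < r -> (forall i, `|x ord0 i| < r) -> `|x| < r.
Proof.
move=> r0 h; rewrite [ltLHS]/Num.norm /= mx_normrE.
by apply/bigmax_ltP; split => // -[i j] _ /=; rewrite ord1.
Qed.

Lemma norm_le_coord x r : 0 <= r -> (forall i, `|x ord0 i| <= r) -> `|x| <= r.
Proof.
move=> r0 h; rewrite [leLHS]/Num.norm /= mx_normrE.
by apply/bigmax_leP; split => // -[i j] _ /=; rewrite ord1.
Qed.

(** An enumeration of the boxes with rational corners, used to pass from local to countable covers.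
    Numbers that code no pair yield an empty box. *)
Definition ratbox (k : nat) : V * V :=
  if @unpickle ('rV[rat]_n.+1 * 'rV[rat]_n.+1)%type k is Some p
  then (map_mx ratr p.1, map_mx ratr p.2) else (0, 0).

Lemma ratbox_nbhs x r : 0 < r -> exists k,
  box (ratbox k).1 (ratbox k).2 x /\
  forall y, box (ratbox k).1 (ratbox k).2 y -> `|y - x| < r.
Proof.
move=> r0.
have lo i : exists q : rat, x ord0 i - r < ratr q < x ord0 i.
  have xr : x ord0 i - r < x ord0 i by rewrite ltrBlDr ltrDl.
  by have [q] := rat_in_itvoo xr; rewrite in_itv/=; exists q.
have hi i : exists q : rat, x ord0 i < ratr q < x ord0 i + r.
  have xr : x ord0 i < x ord0 i + r by rewrite ltrDl.
  by have [q] := rat_in_itvoo xr; rewrite in_itv/=; exists q.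
have [qa qaP] := choice lo; have [qb qbP] := choice hi.
exists (pickle (\row_i qa i, \row_i qb i)); rewrite /ratbox pickleK /=; split.
  move=> i; rewrite !mxE.
  by have /andP[_ /ltW ->] := qaP i; have /andP[-> _] := qbP i.
move=> y yab; apply: norm_lt_coord => // i; have := yab i; rewrite !mxE.
have /andP[q1 q2] := qaP i; have /andP[q3 q4] := qbP i => /andP[q5 q6].
by rewrite ltr_norml; apply/andP; split; lra.
Qed.

Lemma open_ball_norm (O : set V) x : open O -> O x ->
  exists2 r, 0 < r & forall y, `|y - x| < r -> O y.
Proof.
move=> oO Ox; have /nbhs_ballP[r /= r0 rO] : nbhs x O by exact: open_nbhs_nbhs.
by exists r => // y yx; apply: rO; rewrite -ball_normE /= distrC.
Qed.

Lemma open_norm (O : set V) :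
  (forall x, O x -> exists2 r, 0 < r & forall y, `|y - x| < r -> O y) -> open O.
Proof.
move=> h; rewrite openE => x /h[r r0 rO]; apply/nbhs_ballP; exists r => //= y.
by rewrite -ball_normE /= distrC; exact: rO.
Qed.

(** An open set is the union of the rational boxes it contains; the other indices contribute the
    empty set. *)
Lemma open_caratheodory (O : set V) : open O -> mu.-caratheodory O.
Proof.
move=> oO.
pose B k := if `[< box (ratbox k).1 (ratbox k).2 `<=` O >]
            then box (ratbox k).1 (ratbox k).2 else set0.
have -> : O = \bigcup_k B k.
  apply/seteqP; split => x; last first.
    by move=> [k _]; rewrite /B; case: asboolP => // kO /kO.
  move=> /(open_ball_norm oO)[r r0 rO]; have [k [kx kr]] := ratbox_nbhs x r0.
  exists k => //; rewrite /B asboolT// => y /kr; exact: rO.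
apply: caratheodory_measurable_bigcup => k; rewrite /B; case: ifP => _.
  exact: box_caratheodory.
exact: caratheodory_measurable_set0.
Qed.

End BoxMeasurable.

(** * Euclidean geometry *)

Section Euclidean.
Variables (R : realType) (n : nat).
Local Notation V := 'rV[R]_n.+1.
Implicit Types (x y z v : V) (f : V -> V).

Definition dot x y : R := (x *m y^T) ord0 ord0.

(* The library norm on row vectors is the sup norm. *)
Definition enorm x : R := Num.sqrt (dot x x).

Lemma dotE x y : dot x y = \sum_i x ord0 i * y ord0 i.
Proof. by rewrite /dot mxE; apply: eq_bigr => i _; rewrite mxE. Qed.

Lemma dotC x y : dot x y = dot y x.
Proof. by rewrite !dotE; apply: eq_bigr => i _; rewrite mulrC. Qed.

Lemma dotDl x y z : dot (x + y) z = dot x z + dot y z.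
Proof. by rewrite /dot mulmxDl mxE. Qed.

Lemma dotBl x y z : dot (x - y) z = dot x z - dot y z.
Proof. by rewrite /dot mulmxBl !mxE. Qed.

Lemma dotZl c x z : dot (c *: x) z = c * dot x z.
Proof. by rewrite /dot -scalemxAl mxE. Qed.

Lemma dotDr z x y : dot z (x + y) = dot z x + dot z y.
Proof. by rewrite dotC dotDl !(dotC z). Qed.

Lemma dotBr z x y : dot z (x - y) = dot z x - dot z y.
Proof. by rewrite dotC dotBl !(dotC z). Qed.

Lemma dotZr c z x : dot z (c *: x) = c * dot z x.
Proof. by rewrite dotC dotZl dotC. Qed.

Lemma dot_ge0 x : 0 <= dot x x.
Proof. by rewrite dotE; apply: sumr_ge0 => i _; rewrite -expr2 sqr_ge0. Qed.

Lemma enorm_ge0 x : 0 <= enorm x.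
Proof. exact: sqrtr_ge0. Qed.

Lemma enorm_sqr x : enorm x ^+ 2 = dot x x.
Proof. by rewrite sqr_sqrtr// dot_ge0. Qed.

Lemma enormZ c x : enorm (c *: x) = `|c| * enorm x.
Proof.
by rewrite /enorm dotZl dotZr mulrA -expr2 sqrtrM ?sqr_ge0// sqrtr_sqr.
Qed.

Lemma enormN x : enorm (- x) = enorm x.
Proof. by rewrite -scaleN1r enormZ normrN1 mul1r. Qed.

Lemma enorm_distC x y : enorm (x - y) = enorm (y - x).
Proof. by rewrite -enormN opprB. Qed.

Lemma enorm0 : enorm 0 = 0.
Proof. by rewrite -(scale0r (0 : V)) enormZ normr0 mul0r. Qed.

Lemma norm_le_enorm x : `|x| <= enorm x.
Proof.
apply: norm_le_coord => [|i]; first exact: enorm_ge0.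
rewrite -sqrtr_sqr ler_sqrt ?dot_ge0// dotE (bigD1 i)//= -expr2 lerDl.
by apply: sumr_ge0 => j _; rewrite -expr2 sqr_ge0.
Qed.

Lemma enorm_le_norm x : enorm x <= n.+1%:R * `|x|.
Proof.
rewrite -(ler_pXn2r (_ : 0 < 2)%N) ?nnegrE ?enorm_ge0 ?mulr_ge0//.
rewrite enorm_sqr dotE exprMn.
apply: (@le_trans _ _ (\sum_(i < n.+1) `|x| ^+ 2)).
  apply: ler_sum => i _; rewrite -expr2 -real_normK ?num_real//.
  by rewrite ler_pXn2r ?nnegrE// coord_le_norm.
rewrite sumr_const card_ord -[leLHS]mulr_natl ler_wpM2r ?sqr_ge0//.
by rewrite expr2 -natrM ler_nat leq_pmulr.
Qed.

Lemma enorm_eq0 x : enorm x = 0 -> x = 0.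
Proof.
move=> x0; apply/normr0_eq0/eqP; rewrite eq_le normr_ge0 andbT -x0.
exact: norm_le_enorm.
Qed.

Lemma dot_le_enorm x y : dot x y <= enorm x * enorm y.
Proof.
have [/enorm_eq0 ->|x0] := eqVneq (enorm x) 0.
  by rewrite -(scale0r (0 : V)) dotZl mul0r enormZ normr0 !mul0r.
have [/enorm_eq0 ->|y0] := eqVneq (enorm y) 0.
  by rewrite -(scale0r (0 : V)) dotZr mul0r enormZ normr0 !mul0r mulr0.
have xy0 : 0 < enorm x * enorm y.
  by rewrite lt_neqAle mulr_ge0 ?enorm_ge0// eq_sym mulf_neq0.
(* Expanded, this square is twice [enorm x * enorm y] times the gap in the Cauchy-Schwarz
   inequality. *)
have := dot_ge0 (enorm y *: x - enorm x *: y).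
rewrite !(dotBl, dotBr, dotZl, dotZr) (dotC y x) -!enorm_sqr => h.
rewrite -subr_ge0 -(pmulr_rge0 _ xy0); set p := enorm x in h *.
set q := enorm y in h *; set d := dot x y in h *.
by move: h; rewrite expr2 => h; nra.
Qed.

Lemma enormD x y : enorm (x + y) <= enorm x + enorm y.
Proof.
rewrite -(ler_pXn2r (_ : 0 < 2)%N) ?nnegrE ?enorm_ge0 ?addr_ge0 ?enorm_ge0//.
rewrite enorm_sqr !(dotDl, dotDr) (dotC y x) -!enorm_sqr.
by have := dot_le_enorm x y; nra.
Qed.

Lemma enorm_dist y x z : enorm (x - z) <= enorm (x - y) + enorm (y - z).
Proof. by have := enormD (x - y) (y - z); rewrite addrA subrK. Qed.

Lemma enorm_orthogonal (J : 'M[R]_n.+1) x :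
  orthogonal_mx J -> enorm (x *m J) = enorm x.
Proof.
move=> JJ; rewrite /enorm /dot trmx_mul mulmxA -(mulmxA x) JJ mulmx1.
by [].
Qed.

Lemma polarization x y : dot x y *+ 2 = enorm x ^+ 2 + enorm y ^+ 2 - enorm (x - y) ^+ 2.
Proof. by rewrite !enorm_sqr !(dotBl, dotBr) (dotC y x); ring. Qed.

Lemma dot_delta x i : dot x (delta_mx ord0 i) = x ord0 i.
Proof.
rewrite dotE (bigD1 i)//= mxE !eqxx mulr1 big1 ?addr0// => j ji.
by rewrite mxE eqxx (negbTE ji) mulr0.
Qed.

Lemma norm_scale_delta r i : 0 < r ->
  `|(r / 2) *: delta_mx ord0 i : V| < r.
Proof.
move=> r0; apply: norm_lt_coord => // j; rewrite !mxE eqxx/=.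
by case: (j == i); rewrite ?mulr1 ?mulr0 ?normr0// ger0_norm; lra.
Qed.

(** By polarization the increment map [g] preserves dot products. The images of scaled basis vectors
    then form an orthogonal matrix, and the dot products of [g h] with them recover the coordinates
    of [h]. *)
Lemma isometry_affine f x r : 0 < r ->
  (forall y z, `|y - x| < r -> `|z - x| < r ->
     enorm (f y - f z) = enorm (y - z)) ->
  exists (M : 'M[R]_n.+1) (c : V), orthogonal_mx M /\
    forall y, `|y - x| < r -> f y = y *m M + c.
Proof.
move=> r0 iso; pose g h : V := f (x + h) - f x.
have gdot h k : `|h| < r -> `|k| < r -> dot (g h) (g k) = dot h k.
  move=> hr kr; have x0 : `|x - x| < r by rewrite subrr normr0.
  have xE (w : V) : x + w - x = w by rewrite addrC addKr.
  apply: (@pmulrnI _ 2) => //; rewrite !polarization.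
  have -> : g h - g k = f (x + h) - f (x + k) by rewrite /g opprB addrA subrK.
  rewrite !iso ?xE// (_ : x + h - (x + k) = h - k)//.
  by rewrite opprD addrACA subrr add0r.
(* Unit basis vectors may leave the ball on which [f] is isometric; those of length [r / 2] do
   not. *)
pose s := r / 2; have s0 : s != 0 by rewrite gt_eqF// divr_gt0.
pose e i : V := s *: delta_mx ord0 i.
pose M : 'M[R]_n.+1 := \matrix_(i, j) (s^-1 * g (e i) ord0 j).
have er i : `|e i| < r by exact: norm_scale_delta.
have mulMT h i : `|h| < r -> \sum_j g h ord0 j * M i j = h ord0 i.
  move=> hr; under eq_bigr => j _ do rewrite [M i j]mxE mulrCA.
  by rewrite -mulr_sumr -dotE gdot// dotZr dot_delta mulKf.
have MMT : M *m M^T = 1%:M.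
  apply/matrixP => i j; rewrite mxE.
  under eq_bigr => k _ do rewrite [M i k]mxE [M^T k j]mxE -mulrA.
  by rewrite -mulr_sumr mulMT// !mxE eqxx/= mulKf// eq_sym.
exists M, (f x - x *m M); split => // y yx.
have gE : g (y - x) *m M^T = y - x.
  apply/rowP => i; rewrite mxE -[RHS]mulMT//.
  by apply: eq_bigr => j _; rewrite [M^T j i]mxE.
have gM : g (y - x) = (y - x) *m M by rewrite -[in RHS]gE -mulmxA mulmx1C// mulmx1.
have -> : f y = g (y - x) + f x by rewrite /g subrK [x + _]addrC subrK.
by rewrite gM mulmxBl -addrA [- _ + _]addrC.
Qed.

(** This rigidity glues the local affine formulas on overlapping balls. *)
Lemma affine_unique (M M' : 'M[R]_n.+1) (c c' x : V) r : 0 < r ->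
  (forall y, `|y - x| < r -> y *m M + c = y *m M' + c') -> M = M' /\ c = c'.
Proof.
move=> r0 h.
have hx : x *m M + c = x *m M' + c' by apply: h; rewrite subrr normr0.
suff MM' : M = M'.
  by split => //; move: hx; rewrite MM' => /addrI.
have s0 : r / 2 != 0 by rewrite gt_eqF// divr_gt0.
apply/row_matrixP => i; rewrite !rowE.
apply: (scalerI s0); rewrite !scalemxAl; set w := _ *: _.
have := h (w + x); rewrite addrK norm_scale_delta// => /(_ isT).
by rewrite !mulmxDl -!addrA hx => /addIr.
Qed.

Definition eball x r : set V := [set y | enorm (y - x) < r].

Lemma eball_open x r : open (eball x r).
Proof.
apply: open_norm => y yr; have d0 : 0 < r - enorm (y - x) by rewrite subr_gt0.
exists ((r - enorm (y - x)) / n.+1%:R); first by rewrite divr_gt0.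
move=> z; rewrite ltr_pdivlMr// mulrC => zy.
have := le_lt_trans (enorm_le_norm _) zy; rewrite ltrBrDr.
exact/le_lt_trans/enorm_dist.
Qed.

End Euclidean.

(** * Euclidean 1-Lipschitz bound *)

Section LocalLipschitz.
Variables (R : realType) (n : nat).
Local Notation V := 'rV[R]_n.+1.
Local Notation mu := (@lebesgue_outer R n.+1).
Local Notation T := (caratheodory_type mu).
Implicit Types (x y z v w a b : V) (u : V -> V) (A E D : set V).

Let om : {outer_measure set V -> \bar R} := mu.

(** On the Carathéodory sets [mu] is a measure, which gives access to integration and to continuity
    along set sequences. *)
HB.instance Definition _ := isMeasure.Build _ T R (mu : set T -> \bar R)
  (@caratheodory_measure0 _ _ om) (@caratheodory_measure_ge0 _ _ om)
  (@caratheodory_measure_sigma_additive _ _ om).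

Lemma shift_open (E : set V) v : open E -> open [set z | E (z + v)].
Proof.
move=> oE; apply: open_norm => z /(open_ball_norm oE)[r r0 rE]; exists r => // y yz.
by apply: rE; rewrite opprD addrACA subrr addr0.
Qed.

(** The averaging step: integrate the counting inequality over [D] and use that each translate of
    [E] has the measure of [E]. Contraposed, a small [E] is met rarely by the translates of some
    point of [D]. *)
Lemma translate_count E D k (t : 'I_k -> V) (d : R) :
  open E -> mu.-caratheodory D -> 0 <= d ->
  (forall z, D z -> d <= \sum_(j < k) \1_E (z + t j)) ->
  (d%:E * mu D <= k%:R%:E * mu E)%E.
Proof.
move=> oE mD d0 h.
pose m : {measure set T -> \bar R} := (mu : set T -> \bar R).
pose F j : set T := [set z | E (z + t j)].
have mF j : measurable (F j) by apply: open_caratheodory; exact: shift_open.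
have mDT : measurable (D : set T) by [].
have FE j : m (F j) = mu E.
  rewrite (_ : E = [set z + t j | z in (F j : set V)]).
    by rewrite lebesgue_outer_shift.
  apply/seteqP; split => [y Ey|_ [z Fz <-]//].
  by exists (y - t j); rewrite /F /= subrK.
have mind j : measurable_fun (D : set T) (fun z : T => (\1_(F j) z)%:E : \bar R).
  by apply/measurable_EFinP; exact: measurable_indic.
apply: (@le_trans _ _ (\int[m]_(z in (D : set T)) d%:E)%E).
  by rewrite integral_cst.
apply: (@le_trans _ _
  (\int[m]_(z in (D : set T)) \sum_(j < k) (\1_(F j) z)%:E)%E).
  apply: ge0_le_integral => //.
  - exact: emeasurable_sum.
  - by move=> z Dz; rewrite sumEFin lee_fin; exact: h.
rewrite ge0_integral_sum//.
apply: (@le_trans _ _ (\sum_(j < k) mu E)%E).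
  apply: lee_sum => j _; rewrite integral_indic// -(FE j).
  by apply: le_measure; rewrite ?inE//; exact: measurableI.
by rewrite sumr_const card_ord mule_natl.
Qed.

Lemma differentiable_quotient u w v e : differentiable u w -> 0 < e ->
  exists2 d, 0 < d & forall h, 0 < h -> h < d ->
    enorm (u (w + h *: v) - u w) < h * (enorm (v *m jacobian u w) + e).
Proof.
move=> du e0.
have : (fun h => h^-1 *: ((u \o shift w) (h *: v) - u w)) @ 0^' --> 'D_v u w.
  exact: diff_derivable.
rewrite deriveEjacobian// => /cvgrPdist_lt.
have e1 : 0 < e / n.+1%:R by rewrite divr_gt0.
move=> /(_ _ e1) /nbhs_ballP[d /= d0 hd]; exists d => // h h0 hdl.
have := hd h; rewrite /ball /= sub0r normrN gtr0_norm// gt_eqF// => /(_ hdl isT).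
rewrite [_ + w]addrC ltr_pdivlMr// mulrC.
set q := _ - u w; set J := v *m _ => qJ.
have -> : q = h *: (J - (J - h^-1 *: q)).
  by rewrite opprB addrC subrK scalerA divff ?scale1r// gt_eqF.
rewrite enormZ gtr0_norm// ltr_pM2l//.
apply: le_lt_trans (enormD _ _) _; rewrite ler_ltD// enormN.
exact: le_lt_trans (enorm_le_norm _) qJ.
Qed.

Lemma enorm_telescope (p : nat -> V) k :
  enorm (p k - p 0%N) <= \sum_(j < k) enorm (p j.+1 - p j).
Proof.
elim: k => [|k IH]; first by rewrite subrr enorm0 big_ord0.
rewrite big_ord_recr/= addrC; apply: le_trans (enorm_dist (p k) _ _) _.
by rewrite lerD2l.
Qed.

Lemma norm_segment x a v t r : 0 <= t <= 1 -> `|a - x| < r -> `|a + v - x| < r ->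
  `|a + t *: v - x| < r.
Proof.
move=> /andP[t0 t1] ar avr.
have -> : a + t *: v - x = (1 - t) *: (a - x) + t *: (a + v - x).
  by apply/rowP => i; rewrite !mxE; ring.
apply: le_lt_trans (ler_normD _ _) _; rewrite !normrZ !ger0_norm ?subr_ge0//.
have [->|t00] := eqVneq t 0; first by rewrite subr0 mul1r mul0r addr0.
have tp : 0 < t by rewrite lt_neqAle eq_sym t00.
have : t * `|a + v - x| < t * r by rewrite ltr_pM2l.
have : (1 - t) * `|a - x| <= (1 - t) * r by rewrite ler_wpM2l ?subr_ge0// ltW.
by lra.
Qed.

(** The bad set at scale [1/(k+1)]. Both endpoints are kept in the ball, where the Lipschitz bound
    applies, and strict inequalities make the set open. *)
Definition steep u x r v e (k : nat) : set V := [set w |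
  [/\ `|w - x| < r, `|w + k.+1%:R^-1 *: v - x| < r &
      k.+1%:R^-1 * (enorm v + e) < enorm (u (w + k.+1%:R^-1 *: v) - u w)]].

Section Ball.
Variables (u : V -> V) (x : V) (r K : R) (Z : set V).
Hypothesis K0 : 0 <= K.
Hypothesis lip : forall y z, `|y - x| < r -> `|z - x| < r ->
  enorm (u y - u z) <= K * enorm (y - z).
Hypothesis Z0 : mu Z = 0%E.
Hypothesis dZ : forall y, `|y - x| < r -> ~ Z y ->
  differentiable u y /\ orthogonal_mx (jacobian u y).

Lemma steep_open v e k : open (steep u x r v e k).
Proof.
apply: open_norm => w [wr hr]; set h := _ *: v in hr *.
set c := _ * _ => gap.
pose g := enorm (u (w + h) - u w) - c.
have g0 : 0 < g by rewrite subr_gt0.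
pose q := K * n.+1%:R; have q0 : 0 <= q by rewrite mulr_ge0.
(* Moving [w] moves each of the two values of [u] by at most [q] times the displacement, so the gap
   [g] survives; the added 1 guards against [q = 0]. *)
pose d := Num.min (g / (2 * q + 1)) (Num.min (r - `|w - x|) (r - `|w + h - x|)).
exists d; first by rewrite !lt_min !subr_gt0 wr hr divr_gt0//; lra.
move=> y; rewrite !lt_min => /and3P[yg yr yhr].
have yx : `|y - x| < r.
  by have := ler_distD w y x; move: yr; rewrite ltrBrDr => /[swap]; exact: le_lt_trans.
have yhx : `|y + h - x| < r.
  have := ler_distD (w + h) (y + h) x.
  rewrite opprD addrACA subrr addr0 => /le_lt_trans; apply.
  by move: yhr; rewrite ltrBrDr.
split => //; rewrite -/h -/c.
have lipq y1 y2 : `|y1 - x| < r -> `|y2 - x| < r ->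
    enorm (u y1 - u y2) <= q * `|y1 - y2|.
  move=> y1r y2r; apply: le_trans (lip y1r y2r) _.
  by rewrite /q -mulrA ler_wpM2l// enorm_le_norm.
have l1 := lipq _ _ hr yhx; have l2 := lipq _ _ yx wr.
rewrite opprD addrACA subrr addr0 distrC in l1.
have t1 := enorm_dist (u (y + h)) (u (w + h)) (u w).
have t2 := enorm_dist (u y) (u (y + h)) (u w).
move: yg; rewrite ltr_pdivlMr; last by lra.
rewrite mulrDr mulr1 => yg; have := normr_ge0 (y - w).
move: l1 l2 t1 t2 yg; rewrite /g; nra.
Qed.

(** Off [Z] the difference quotients along [v] tend to a vector of length [enorm v], so a point is
    steep at only finitely many scales. The limit superior of the steep sets thus lies in the null
    set [Z], and continuity from above applies. *)
Lemma steep_small v e d : 0 < e -> 0 < d ->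
  exists k, (mu (steep u x r v e k) < d%:E)%E.
Proof.
move=> e0 d0; pose F k : set T := steep u x r v e k.
pose m : {measure set T -> \bar R} := (mu : set T -> \bar R).
have mF k : measurable (F k) by apply: open_caratheodory; exact: steep_open.
(* Continuity from above needs finite measure: all steep sets lie in one bounded box. *)
have Foo : (m (\bigcup_(k >= 0%N) F k) < +oo)%E.
  apply: (@le_lt_trans _ _ (mu (box (x - const_mx r) (x + const_mx r)))).
    apply: le_lebesgue_outer => w [k _ [wr _ _]] i; rewrite !mxE.
    have := le_lt_trans (coord_le_norm (w - x) i) wr; rewrite !mxE ltr_norml.
    by move=> /andP[? ?]; apply/andP; split; lra.
  by rewrite lebesgue_outer_box ltry.
have limF : m (lim_sup_set F) = 0%E.
  apply/eqP; rewrite eq_le measure_ge0 andbT -Z0.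
  apply: le_lebesgue_outer => w wF; apply: contrapT => wZ.
  have [k _ [wr _ _]] := wF 0%N I.
  have [du orth] := dZ wr wZ.
  have [h h0 hq] := differentiable_quotient v du e0.
  have [N Nh] : exists N : nat, N.+1%:R^-1 < h.
    have := near_infty_natSinv_lt (PosNum h0) => -[N _ Nh].
    by exists N; exact: Nh (leqnn N).
  have [j /= Nj [_ _]] := wF N I.
  rewrite ltNge => /negP; apply; apply: ltW.
  rewrite -(enorm_orthogonal v orth); apply: hq => //.
  by apply: le_lt_trans Nh; rewrite lef_pV2 ?posrE// ler_nat ltnS.
have := lim_sup_set_cvg m F mF Foo; rewrite limF => cvF.
have /cvF[N _ hN] : nbhs (0%E : \bar R) [set y | (y < d%:E)%E].
  by apply: open_nbhs_nbhs; split; [exact: open_ereal_lt_ereal|rewrite /= lte_fin].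
exists N; apply: le_lt_trans (hN N (leqnn N)).
by apply: le_lebesgue_outer => w; exists N => /=.
Qed.

Lemma ball_nonexpansive a b : `|a - x| < r -> `|b - x| < r ->
  enorm (u b - u a) <= enorm (b - a).
Proof.
move=> ar br; pose v := b - a; have avE : a + v = b by rewrite addrC subrK.
apply/ler_addgt0Pr => e3 e30; pose e := e3 / 3.
have e0 : 0 < e by rewrite divr_gt0.
pose q := K * n.+1%:R; have q0 : 0 <= q by rewrite mulr_ge0.
(* Small enough that shifting the segment from [a] to [b] by a vector of this size keeps both
   endpoints in the ball and changes the values of [u] there by at most [e] in total. *)
pose rho := Num.min (e / (2 * q + 1)) (Num.min (r - `|a - x|) (r - `|b - x|)) / 2.
have rho0 : 0 < rho.
  by rewrite divr_gt0// !lt_min !subr_gt0 ar br divr_gt0//; lra.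
pose D := box (a - const_mx rho) (a + const_mx rho).
have Dnear z : D z -> [/\ `|z - x| < r, `|z + v - x| < r &
    2 * q * `|z - a| <= e].
  move=> Dz; have za : `|z - a| <= rho.
    apply: norm_le_coord => [|i]; first exact: ltW.
    have := Dz i; rewrite !mxE ler_norml => /andP[? ?].
    by apply/andP; split; lra.
  have {}za : `|z - a| < rho * 2 by lra.
  move: za; rewrite /rho divfK// !lt_min => /and3P[zq zar zbr].
  split.
  - by have := ler_distD a z x; move: zar; rewrite ltrBrDr => /[swap]; exact: le_lt_trans.
  - have := ler_distD b (z + v) x.
    have -> : z + v - b = z - a by rewrite -avE opprD addrACA subrr addr0.
    by move: zbr; rewrite ltrBrDr => /[swap]; exact: le_lt_trans.
  - move: zq; rewrite ltr_pdivlMr; last by lra.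
    by have := normr_ge0 (z - a); nra.
have Dvol : (0 : R) < box_vol (a - const_mx rho) (a + const_mx rho).
  apply: prodr_gt0 => i _; rewrite lt_max !mxE; apply/orP; right; lra.
(* The admissible fraction of steep steps: even at the Lipschitz rate [K] they add at most [e]. *)
pose dl := e / (K * enorm v + 1).
have Kv0 : 0 <= K * enorm v by rewrite mulr_ge0 ?enorm_ge0.
have dl0 : 0 < dl by rewrite divr_gt0// ltr_wpDl.
have [k kS] := steep_small v e0 (mulr_gt0 dl0 Dvol).
set S := steep u x r v e k in kS.
pose t (j : nat) : V := (j%:R / k.+1%:R) *: v.
(* Some segment parallel to [v], starting near [a], has few steep steps. *)
have [z Dz zS] : exists2 z, D z & \sum_(j < k.+1) \1_S (z + t j) < dl * k.+1%:R :> R.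
  apply: contrapT => nz.
  have : ((dl * k.+1%:R)%:E * mu D <= k.+1%:R%:E * mu S)%E.
    apply: (translate_count (t := fun j : 'I_k.+1 => t j)).
    - exact: steep_open.
    - exact: box_caratheodory.
    - by rewrite mulr_ge0// ltW.
    - by move=> z Dz; rewrite leNgt; apply/negP => zS; apply: nz; exists z.
  rewrite lebesgue_outer_box -EFinM mulrAC EFinM muleC lee_pmul2l//.
  by rewrite leNgt kS.
have [zr zvr zaq] := Dnear z Dz.
have tS j : t j.+1 = t j + k.+1%:R^-1 *: v.
  by rewrite /t -scalerDl -natr1 mulrDl mul1r.
have tr j : (j <= k.+1)%N -> `|z + t j - x| < r.
  move=> jk; apply: norm_segment => //; apply/andP; split.
    by rewrite divr_ge0.
  by rewrite ler_pdivrMr// mul1r ler_nat.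
(* A steep step is charged the Lipschitz bound, any other step the bound defining [steep]. *)
have step (j : 'I_k.+1) : enorm (u (z + t j.+1) - u (z + t j)) <=
    k.+1%:R^-1 * (enorm v + e) + \1_S (z + t j) * (K * (k.+1%:R^-1 * enorm v)).
  have jr : `|z + t j - x| < r by apply: tr; exact/ltnW.
  have j1r : `|z + t j.+1 - x| < r by apply: tr.
  rewrite indicE; have [_|/negP jS] := boolP (_ \in S).
    apply: le_trans (lip j1r jr) _.
    rewrite opprD addrACA subrr add0r tS [t j + _]addrC addrK mul1r.
    rewrite enormZ gtr0_norm ?invr_gt0// lerDr mulr_ge0// ?invr_ge0// ltW//.
    by rewrite ltr_wpDl ?enorm_ge0.
  rewrite mul0r addr0 leNgt; apply/negP => steep_j; apply: jS; apply/mem_set.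
  have zE : z + t j + k.+1%:R^-1 *: v = z + t j.+1 by rewrite tS addrA.
  by split; rewrite ?zE.
have tele : enorm (u (z + v) - u z) <= enorm v + e + dl * (K * enorm v).
  have := enorm_telescope (fun j => u (z + t j)) k.+1.
  rewrite /t divff ?scale1r// mul0r scale0r addr0 -/t => /le_trans; apply.
  apply: le_trans (ler_sum _ (fun j _ => step j)) _.
  rewrite big_split/= sumr_const card_ord -[X in X + _]mulr_natl mulVKf//.
  rewrite lerD2l -mulr_suml (mulrCA K) (mulrA (\sum_(i < _) _)) ler_wpM2r//.
  by rewrite ler_pdivrMr// ltW.
have dlK : dl * (K * enorm v) <= e.
  rewrite /dl mulrAC ler_pdivrMr ?ltr_wpDl//; nra.
have lipq y1 y2 : `|y1 - x| < r -> `|y2 - x| < r ->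
    enorm (u y1 - u y2) <= q * `|y1 - y2|.
  move=> y1r y2r; apply: le_trans (lip y1r y2r) _.
  by rewrite /q -mulrA ler_wpM2l// enorm_le_norm.
have l1 := lipq _ _ br zvr; have l2 := lipq _ _ zr ar.
have t1 := enorm_dist (u (z + v)) (u b) (u a).
have t2 := enorm_dist (u z) (u (z + v)) (u a).
move: l1; rewrite -{2}avE opprD addrACA subrr addr0 distrC => l1.
(* One [e] each for the slack of ordinary steps, for the steep steps, and for moving the segment
   back to [a] and [b]. *)
by rewrite -/v (_ : e3 = e + e + e); [lra|rewrite /e; lra].
Qed.

End Ball.

End LocalLipschitz.

(** * Measure of images *)

Section ImageMeasure.
Variables (R : realType) (n : nat).
Local Notation V := 'rV[R]_n.+1.
Local Notation mu := (@lebesgue_outer R n.+1).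
Implicit Types (x y z v w a b : V) (A E D : set V).

Definition nonexpansive_on (A : set V) (u : V -> V) :=
  forall y z, A y -> A z -> enorm (u y - u z) <= enorm (y - z).

Definition sup_coord a b : V := \row_i Num.max (a ord0 i) (b ord0 i).
Definition inf_coord a b : V := \row_i Num.min (a ord0 i) (b ord0 i).

Lemma box_setI a b p q :
  box a b `&` box p q = box (sup_coord a p) (inf_coord b q).
Proof.
apply/seteqP; split => [x [abx pqx] i|x h].
  rewrite !mxE ge_max lt_min.
  by have /andP[-> ->] := abx i; have /andP[-> ->] := pqx i.
by split => i; have := h i; rewrite !mxE ge_max lt_min => /andP[/andP[? ?] /andP[? ?]];
  apply/andP.
Qed.

Lemma box_vol_setI a b p q :
  box_vol (sup_coord a p) (inf_coord b q) <= box_vol a b.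
Proof.
apply: ler_prod => i _; rewrite le_max lexx/= !mxE.
by rewrite ge_max le_max lexx/= le_max lerB ?orbT// ?ge_min ?le_max ?lexx.
Qed.

Section InBox.
Variables (u : V -> V) (p q : V).
Hypothesis u1 : nonexpansive_on (box p q) u.

Definition box_contraction (c : R) := forall a b, box a b `<=` box p q ->
  (mu (u @` box a b) <= (c * box_vol a b)%:E)%E.

(** The bound passes from boxes to arbitrary subsets through covers; intersecting the covering boxes
    with [box p q] keeps them where the hypothesis on [u] holds. *)
Lemma box_contraction_sub c A : 0 <= c -> box_contraction c ->
  A `<=` box p q -> (mu (u @` A) <= c%:E * mu A)%E.
Proof.
move=> c0 cc Apq.
have Afin : mu A \is a fin_num.
  rewrite ge0_fin_numE ?lebesgue_outer_ge0//.
  apply: le_lt_trans (le_lebesgue_outer Apq) _.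
  by rewrite lebesgue_outer_box ltry.
apply/lee_addgt0Pr => e e0.
have e1 : 0 < e / (c + 1) by rewrite divr_gt0// ltr_wpDl.
have [a [b [Aab sum_le]]] := lebesgue_outer_adherent Afin e1.
pose a' k := sup_coord (a k) p; pose b' k := inf_coord (b k) q.
apply: (@le_trans _ _ (mu (\bigcup_k (u @` box (a' k) (b' k))))).
  apply: le_lebesgue_outer => _ [x Ax <-]; have [k _ kx] := Aab _ Ax.
  by exists k => //; exists x => //; rewrite -box_setI; split => //; exact: Apq.
apply: le_trans (lebesgue_outer_sigma_subadditive _) _.
apply: (@le_trans _ _ (\sum_(k <oo) c%:E * (box_vol (a k) (b k))%:E)%E).
  apply: lee_nneseries => [k _ _|k _]; first exact: lebesgue_outer_ge0.
  apply: (le_trans (cc _ _ _)); first by rewrite -box_setI; exact: subIsetr.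
  by rewrite -EFinM lee_fin ler_wpM2l// box_vol_setI.
rewrite nneseriesZl//; last by move=> k _; rewrite lee_fin box_vol_ge0.
apply: (@le_trans _ _ (c%:E * (mu A + (e / (c + 1))%:E))%E).
  by rewrite lee_wpmul2l.
rewrite muleDr//; last by rewrite fin_num_adde_defl.
apply: leeD2l; rewrite -EFinM lee_fin mulrCA ger_pMr//.
by rewrite ler_pdivrMr ?mul1r ?lerDl// ltr_wpDl.
Qed.

(* Halving the longest sides cuts a box into pieces of side ratio at most 2. *)
Lemma box_contraction_near_cubes c : 0 <= c ->
  (forall s a b, 0 < s -> (forall i, s <= b ord0 i - a ord0 i <= 2 * s) ->
     box a b `<=` box p q -> (mu (u @` box a b) <= (c * box_vol a b)%:E)%E) ->
  box_contraction c.
Proof.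
move=> c0 cubes a b abpq.
have [[i bai]|pos] := pselect (exists i, b ord0 i <= a ord0 i).
  rewrite (box_empty bai) image_set0 lebesgue_outer0 lee_fin.
  by rewrite mulr_ge0// box_vol_ge0.
have {}pos i : 0 < b ord0 i - a ord0 i.
  by rewrite subr_gt0 ltNge; apply/negP => bai; apply: pos; exists i.
have [s s0 sab] : exists2 s, 0 < s & forall i, s <= b ord0 i - a ord0 i.
  have [j _ jmin] := @arg_minP _ _ _ ord0 predT
    (fun i => b ord0 i - a ord0 i) erefl.
  by exists (b ord0 j - a ord0 j) => // i; exact: jmin.
have [m] : exists m : nat, \sum_i (b ord0 i - a ord0 i) <= m%:R * s.
  exists (Num.truncn ((\sum_i (b ord0 i - a ord0 i)) / s)).+1.
  by rewrite -ler_pdivrMr// ltW// truncnS_gt.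
(* With [s] fixed, the total side length in units of [s] decreases: halving a side longer than
   [2 * s] removes more than [s] and leaves all sides at least [s]. The value 0 is impossible. *)
elim: m a b abpq {pos} sab => [|m IH] a b abpq sab.
  rewrite mul0r leNgt big_ord_recl => /negP[]; rewrite ltr_pwDl//.
    exact: lt_le_trans (sab ord0).
  by apply: sumr_ge0 => i _; apply: le_trans (sab _); exact: ltW.
move=> sumab.
have [small|] := pselect (forall i, b ord0 i - a ord0 i <= 2 * s).
  by apply: (cubes s) => // i; rewrite sab small.
move=> /existsNP[i /negP]; rewrite -ltNge => big_i.
pose h := (a ord0 i + b ord0 i) / 2.
pose b' := set_coord b i (Num.min (b ord0 i) h).
pose a' := set_coord a i (Num.max (a ord0 i) h).
have hb : Num.min (b ord0 i) h = h by rewrite min_r// /h; lra.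
have ha : Num.max (a ord0 i) h = h by rewrite max_r// /h; lra.
have split_ab : box a b = box a b' `|` box a' b.
  by rewrite /b' /a' -box_cut -box_cutC -setIUr setUCr setIT.
have sumD (x y : V) : (forall j, j != i ->
    y ord0 j - x ord0 j = b ord0 j - a ord0 j) ->
    y ord0 i - x ord0 i = (b ord0 i - a ord0 i) / 2 ->
    \sum_j (y ord0 j - x ord0 j) <= m%:R * s.
  move=> xyj xyi; move: sumab; rewrite (bigD1 i)//= [X in _ -> X <= _](bigD1 i)//=.
  by rewrite (eq_bigr _ xyj) xyi -natr1 mulrDl mul1r; lra.
rewrite -(box_vol_cut a b i h) -/a' -/b' split_ab image_setU mulrDr EFinD.
apply: le_trans (outer_measureU2 _ _ _) _; apply: leeD; apply: IH.
- by apply: subset_trans abpq; rewrite split_ab; exact: subsetUl.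
- move=> j; rewrite /b' mxE; case: eqP => [->|_]; last exact: sab.
  by rewrite hb /h; lra.
- apply: sumD => [j /negbTE ji|]; first by rewrite mxE ji.
  by rewrite mxE eqxx hb /h; lra.
- by apply: subset_trans abpq; rewrite split_ab; exact: subsetUr.
- move=> j; rewrite /a' mxE; case: eqP => [->|_]; last exact: sab.
  by rewrite ha /h; lra.
- apply: sumD => [j /negbTE ji|]; first by rewrite mxE ji.
  by rewrite mxE eqxx ha /h; lra.
Qed.

Let N : R := n.+1%:R.

Lemma box_vol_scale_le (k : R) (y z a b : V) : 0 <= k ->
  (forall i, 0 <= z ord0 i - y ord0 i <= k * (b ord0 i - a ord0 i)) ->
  box_vol y z <= k ^+ n.+1 * box_vol a b.
Proof.
move=> k0 h.
have -> : k ^+ n.+1 = \prod_(i < n.+1) k by rewrite prodr_const card_ord.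
rewrite -big_split/=; apply: ler_prod => i _; rewrite le_max lexx/=.
have /andP[h1 h2] := h i; rewrite max_r//; apply: le_trans h2 _.
by rewrite ler_wpM2l// le_max lexx orbT.
Qed.

Lemma box_contraction_init : box_contraction ((4 * N + 2) ^+ n.+1).
Proof.
have N1 : 1 <= N by rewrite ler1n.
have N0 : 0 <= 4 * N + 2 by lra.
apply: box_contraction_near_cubes => [|s a b s0 sab abpq]; first exact: exprn_ge0.
have aab : box a b a.
  by move=> i; rewrite lexx -subr_gt0; have /andP[+ _] := sab i; exact: lt_le_trans.
(* The image lies within [2 * N * s] of [u a] in each coordinate; the extra [s] makes the upper
   bound strict, as a half-open box requires. *)
pose t : V := const_mx ((2 * N + 1) * s).
apply: (@le_trans _ _ (mu (box (u a - t) (u a + t)))).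
  apply: le_lebesgue_outer => _ [y yab <-] i; rewrite !mxE.
  have ya : `|y - a| <= 2 * s.
    apply: norm_le_coord => [|j]; first by rewrite mulr_ge0// ltW.
    rewrite !mxE; have /andP[? ?] := yab j; have /andP[? ?] := sab j.
    by rewrite ger0_norm; lra.
  have uya : `|(u y - u a) ord0 i| <= N * (2 * s).
    apply: le_trans (coord_le_norm _ _) _; apply: le_trans (norm_le_enorm _) _.
    apply: le_trans (u1 _ _) _; [exact: abpq|exact: abpq|].
    by apply: le_trans (enorm_le_norm _) _; rewrite ler_wpM2l.
  move: uya; rewrite !mxE ler_norml => /andP[? ?].
  by apply/andP; split; nra.
rewrite lebesgue_outer_box lee_fin; apply: box_vol_scale_le => // i.
rewrite !mxE; have /andP[? ?] := sab i.
by apply/andP; split; nra.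
Qed.

Lemma eball_shift x y r : mu (eball x r) = mu (eball y r).
Proof.
rewrite -(lebesgue_outer_shift (eball x r) (y - x)); congr (mu _).
apply/seteqP; split => [_ [z zx <-]|z zy].
  by move: zx; rewrite /eball/= addrA addrAC addrK.
exists (z - (y - x)); last by rewrite subrK.
by move: zy; rewrite /eball/= opprB addrA addrAC addrK.
Qed.

(** The source of the sharp factor 1: a Euclidean ball goes into a Euclidean ball of the same
    radius, whereas boxes lose a dimensional constant. *)
Lemma eball_image x r : eball x r `<=` box p q ->
  (mu (u @` eball x r) <= mu (eball x r))%E.
Proof.
move=> Bpq; rewrite [leRHS](eball_shift x (u x)).
apply: le_lebesgue_outer => _ [y yx <-].
apply: le_lt_trans (u1 (Bpq _ yx) (Bpq _ _)) (yx).
rewrite /eball/= subrr enorm0; exact: le_lt_trans (enorm_ge0 _) yx.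
Qed.

(** The inscribed ball counts with factor 1 and the rest with factor [c], which saves [c - 1] times
    the measure of the ball, a fixed fraction of a near-cube. *)
Lemma box_contraction_improve c : 1 <= c -> box_contraction c ->
  box_contraction (c - (c - 1) * (4 * N)^-1 ^+ n.+1).
Proof.
have N1 : 1 <= N by rewrite ler1n.
move=> c1 cc; pose th := (4 * N)^-1 ^+ n.+1.
have th1 : 0 <= th <= 1.
  rewrite exprn_ge0 ?invr_ge0//=; last by lra.
  by apply: exprn_ile1; rewrite ?invr_ge0 ?invf_le1; lra.
apply: box_contraction_near_cubes => [|s a b s0 sab abpq].
  by rewrite -/th; nra.
pose o : V := 2^-1 *: (a + b); pose B := eball o (s / 2).
have Bab : B `<=` box a b.
  move=> y yo i.
  have : `|(y - o) ord0 i| < s / 2.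
    by apply: le_lt_trans yo; apply: le_trans (norm_le_enorm _); exact: coord_le_norm.
  rewrite !mxE ltr_norml => /andP[? ?]; have /andP[? ?] := sab i.
  by apply/andP; split; lra.
have mB : mu.-caratheodory B by apply: open_caratheodory; exact: eball_open.
have Bfin : mu B \is a fin_num.
  rewrite ge0_fin_numE ?lebesgue_outer_ge0//.
  apply: le_lt_trans (le_lebesgue_outer Bab) _.
  by rewrite lebesgue_outer_box ltry.
have Bth : ((th * box_vol a b)%:E <= mu B)%E.
  (* A cube of this half-side lies within Euclidean distance [s / 4] of [o], hence in the ball; its
     side is at least [1 / (4 * N)] times each side of the box. *)
  pose t : V := const_mx (s / (4 * N)).
  apply: (@le_trans _ _ (mu (box (o - t) (o + t)))).
    rewrite lebesgue_outer_box lee_fin -[leRHS](@mulKf _ ((4 * N) ^+ n.+1)); last first.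
      by rewrite gt_eqF// exprn_gt0//; lra.
    rewrite /th exprVn ler_wpM2l ?invr_ge0 ?exprn_ge0//; first by lra.
    apply: box_vol_scale_le => [|i]; first by lra.
    rewrite !mxE; have /andP[? ?] := sab i; apply/andP; split; first by lra.
    have -> : 4 * N * (2^-1 * (a ord0 i + b ord0 i) + s / (4 * N) -
      (2^-1 * (a ord0 i + b ord0 i) - s / (4 * N))) = 2 * s by field; lra.
    lra.
  apply: le_lebesgue_outer => y yo; apply: le_lt_trans (enorm_le_norm _) _.
  apply: (@le_lt_trans _ _ (N * (s / (4 * N)))); last first.
    have -> : N * (s / (4 * N)) = s / 4 by field; lra.
    lra.
  rewrite ler_wpM2l//; apply: norm_le_coord => [|i].
    by rewrite divr_ge0//; lra.
  have := yo i; rewrite !mxE ler_norml; move: (s / (4 * N)) => e /andP[? ?].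
  by apply/andP; split; lra.
have := mB (box a b); rewrite (setIidr Bab) lebesgue_outer_box => volE.
have Afin : mu (box a b `&` ~` B) \is a fin_num.
  rewrite ge0_fin_numE ?lebesgue_outer_ge0//.
  apply: le_lt_trans (le_lebesgue_outer (@subIsetl _ _ _)) _.
  by rewrite lebesgue_outer_box ltry.
rewrite (_ : box a b = B `|` (box a b `&` ~` B)); last first.
  by rewrite setUIr setUCr setIT setUC; exact/esym/setUidl.
rewrite image_setU; apply: le_trans (outer_measureU2 _ _ _) _.
apply: (@le_trans _ _ (mu B + c%:E * mu (box a b `&` ~` B))%E).
  apply: leeD; first by apply: eball_image; exact: subset_trans abpq.
  apply: box_contraction_sub => //; first by lra.
  by apply: subset_trans abpq; exact: subIsetl.
move: volE Bth; rewrite -(fineK Bfin) -(fineK Afin) -EFinM -!EFinD !lee_fin.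
move=> [->]; set be := fine _; set al := fine _ => Bth.
have : 0 <= al by rewrite /al fine_ge0// lebesgue_outer_ge0.
by rewrite -/th; nra.
Qed.

Lemma box_nonexpansive_measure A : A `<=` box p q -> (mu (u @` A) <= mu A)%E.
Proof.
move=> Apq; rewrite -[leRHS]mul1e; apply: box_contraction_sub => //.
have N1 : 1 <= N by rewrite ler1n.
pose th : R := (4 * N)^-1 ^+ n.+1; pose c0 : R := (4 * N + 2) ^+ n.+1.
have th1 : 0 < th <= 1.
  rewrite exprn_gt0 ?invr_gt0//=; last by lra.
  by apply: exprn_ile1; rewrite ?invr_ge0 ?invf_le1; lra.
have c01 : 1 <= c0 by apply: exprn_ege1; lra.
have th2 : 0 <= 1 - th < 1 by move: th1; lra.
(* Each improvement multiplies the excess of the constant over 1 by [1 - th]. *)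
have iter_c k : box_contraction (1 + (1 - th) ^+ k * (c0 - 1)).
  elim: k => [|k /box_contraction_improve].
    by rewrite expr0 mul1r addrC subrK; exact: box_contraction_init.
  rewrite -/th (_ : _ - _ * th = 1 + (1 - th) ^+ k.+1 * (c0 - 1)).
    apply; rewrite lerDl mulr_ge0 ?subr_ge0// exprn_ge0//.
    by have /andP[] := th2.
  by rewrite exprS; ring.
move=> a b abpq; apply/lee_addgt0Pr => e e0.
pose C := (c0 - 1) * box_vol a b.
have C0 : 0 <= C by rewrite mulr_ge0 ?subr_ge0 ?box_vol_ge0.
have : (fun k => (1 - th) ^+ k : R) @ \oo --> (0 : R).
  by apply: cvg_expr; rewrite ger0_norm; have /andP[] := th2.
move=> /cvgrPdist_lt /(_ (e / (C + 1))).
rewrite divr_gt0 ?ltr_wpDl// => /(_ isT)[k _ /(_ k (leqnn k))] /=.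
rewrite sub0r normrN ger0_norm; last by rewrite exprn_ge0//; have /andP[] := th2.
rewrite ltr_pdivlMr ?ltr_wpDl// => ke.
apply: le_trans (iter_c k _ _ abpq) _; rewrite -EFinD lee_fin.
rewrite mulrDl lerD2l -mulrA -/C.
have : 0 <= (1 - th) ^+ k by rewrite exprn_ge0//; have /andP[] := th2.
by move: ke; rewrite mulrDr; lra.
Qed.

End InBox.
End ImageMeasure.

(** * Local isometry and affinity *)

Section LocalIsometry.
Variables (R : realType) (n : nat).
Local Notation V := 'rV[R]_n.+1.
Local Notation mu := (@lebesgue_outer R n.+1).
Implicit Types (x y z v w a b : V) (A B D : set V).

(** Countably many rational boxes on which [u] is nonexpansive cover [A]. Made disjoint, they cut
    even a nonmeasurable [A] into pieces whose measures sum to at most that of [A]. *)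
Lemma nonexpansive_measure (u : V -> V) A :
  (forall x, A x -> exists2 r, 0 < r &
     nonexpansive_on [set y | `|y - x| < r] u) ->
  (mu (u @` A) <= mu A)%E.
Proof.
move=> loc.
pose G k := let ab := @ratbox R n k in
  if `[< nonexpansive_on (box ab.1 ab.2) u >] then box ab.1 ab.2 else set0.
have GA : A `<=` \bigcup_k G k.
  move=> x /loc[r r0 ur]; have [k [kx kr]] := ratbox_nbhs x r0.
  exists k => //; rewrite /G asboolT// => y z /kr yr /kr zr; exact: ur.
have mG k : mu.-caratheodory (G k).
  rewrite /G; case: ifP => _; first exact: box_caratheodory.
  exact: caratheodory_measurable_set0.
have uG k D : D `<=` G k -> (mu (u @` D) <= mu D)%E.
  rewrite /G; case: asboolP => [u1|_] DG; first exact: box_nonexpansive_measure DG.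
  by move: DG; rewrite subset0 => ->; rewrite image_set0.
pose F := seqDU G.
have mF k : mu.-caratheodory (F k).
  apply: caratheodory_measurable_setD => //.
  exact: caratheodory_measurable_bigsetU.
apply: (@le_trans _ _ (mu (\bigcup_k (u @` (A `&` F k))))).
  apply: le_lebesgue_outer => _ [x Ax <-].
  have : (\bigcup_k F k) x by rewrite /F -seqDU_bigcup_eq; exact: GA.
  by move=> [k _ Fx]; exists k => //; exists x.
apply: le_trans (outer_measure_sigma_subadditive _ _) _.
apply: (@le_trans _ _ (\sum_(k <oo) mu (A `&` F k))%E).
  apply: lee_nneseries => [k _ _|k _]; first exact: lebesgue_outer_ge0.
  by apply: (uG k) => x [_ []].
apply: le_trans (caratheodory_lime_le mF (trivIset_seqDU G) A).
by rewrite leeDl// lebesgue_outer_ge0.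
Qed.

Lemma open_measure_gt0 (O : set V) x : open O -> O x -> (0 < mu O)%E.
Proof.
move=> oO /(open_ball_norm oO)[r r0 rO]; pose t : V := const_mx (r / 2).
apply: (@lt_le_trans _ _ (mu (box (x - t) (x + t)))).
  rewrite lebesgue_outer_box lte_fin; apply: prodr_gt0 => i _.
  by rewrite lt_max !mxE; apply/orP; right; lra.
apply: le_lebesgue_outer => y yt; apply: rO.
apply: (@le_lt_trans _ _ (r / 2)); last by lra.
apply: norm_le_coord => [|i]; first by lra.
by have := yt i; rewrite !mxE ler_norml => /andP[? ?]; apply/andP; split; lra.
Qed.

Variables (u : V -> V) (U : set V).
Hypothesis oU : open U.
Hypothesis Ufin : mu U \is a fin_num.
Hypothesis muU : mu U = mu (u @` U).
Hypothesis loc : forall x, U x -> exists2 r, 0 < r &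
  nonexpansive_on [set y | `|y - x| < r] u.

(** A loss on [A] could not be made up on the rest of [U], whose image does not grow, while [U] and
    its image have equal finite measure. *)
Lemma nonexpansive_measure_preserving A : A `<=` U -> mu.-caratheodory A ->
  (mu A <= mu (u @` A))%E.
Proof.
move=> AU mA.
have fin_sub D : D `<=` U -> mu D \is a fin_num.
  move=> DU; rewrite ge0_fin_numE ?lebesgue_outer_ge0//.
  apply: le_lt_trans (le_lebesgue_outer DU) _.
  by rewrite -ge0_fin_numE ?lebesgue_outer_ge0.
have UA : U `&` ~` A `<=` U by exact: subIsetl.
have := mA U; rewrite (setIidr AU) muU => UE.
have : (mu (u @` U) <= mu (u @` A) + mu (U `&` ~` A))%E.
  rewrite {1}(_ : U = A `|` (U `&` ~` A)); last first.
    by rewrite setUIr setUCr setIT setUC; exact/esym/setUidl.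
  rewrite image_setU; apply: le_trans (outer_measureU2 _ _ _) _.
  by apply: leeD2l; apply: nonexpansive_measure => x /UA; exact: loc.
by rewrite UE leeD2rE// fin_sub.
Qed.

Lemma locally_isometric x : U x -> exists2 r, 0 < r &
  forall y z, `|y - x| < r -> `|z - x| < r -> enorm (u y - u z) = enorm (y - z).
Proof.
move=> Ux; have [r1 r10 r1U] := open_ball_norm oU Ux; have [r2 r20 ur2] := loc Ux.
pose r := Num.min r1 r2; have r0 : 0 < r by rewrite lt_min r10.
have N1 : (1 : R) <= n.+1%:R by rewrite ler1n.
(* For [y] and [z] this close to [x], the balls of radius below [d / 2] used next stay within the
   radius [r]; the factor [n.+1] converts sup norm to Euclidean norm. *)
have rho0 : 0 < r / (4 * n.+1%:R) by rewrite divr_gt0//; lra.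
have rho4 : 3 * n.+1%:R * (r / (4 * n.+1%:R)) < r.
  have -> : 3 * n.+1%:R * (r / (4 * n.+1%:R)) = 3 / 4 * r by field; lra.
  lra.
exists (r / (4 * n.+1%:R)) => //; move: (r / _) rho0 rho4 => rho rho0 rho4 y z yx zx.
have rho_r : rho < r by nra.
have yr : `|y - x| < r by exact: lt_trans rho_r.
have zr : `|z - x| < r by exact: lt_trans rho_r.
have ur w w' : `|w - x| < r -> `|w' - x| < r -> enorm (u w - u w') <= enorm (w - w').
  by rewrite !lt_min => /andP[_ wr] /andP[_ wr']; exact: ur2.
apply/eqP; rewrite eq_le ur//= leNgt; apply/negP.
set d := enorm (y - z); set d' := enorm (u y - u z) => dd.
have d'0 : 0 <= d' := enorm_ge0 _.
(* Strictly between [d' / 2] and [d / 2]: balls of radius [s] about [y] and [z] are disjoint, while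
   those about [u y] and [u z] share the midpoint. *)
pose s := (d + d') / 4; have s0 : 0 < s by rewrite /s; lra.
have d_le : d <= n.+1%:R * (2 * rho).
  apply: le_trans (enorm_le_norm _) _; rewrite ler_wpM2l//.
  by have := ler_distD x y z; rewrite [`|x - z|]distrC; lra.
have ball_r c w : `|c - x| < rho -> eball c s w -> `|w - x| < r.
  move=> cx wc; have h1 : `|w - c| < s := le_lt_trans (norm_le_enorm _) wc.
  have := ler_distD c w x; rewrite /s in h1; nra.
have ball_U c : `|c - x| < rho -> eball c s `<=` U.
  by move=> cx w /(ball_r _ _ cx); rewrite lt_min => /andP[/r1U].
have ball_u c : `|c - x| < rho -> u @` eball c s `<=` eball (u c) s.
  move=> cx _ [w wc <-]; apply: le_lt_trans (ur _ _ _ _) (wc); first exact: ball_r wc.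
  exact: lt_trans rho_r.
pose B1 := eball y s; pose B2 := eball z s.
pose E1 := eball (u y) s; pose E2 := eball (u z) s.
have mball c : mu.-caratheodory (eball c s).
  by apply: open_caratheodory; exact: eball_open.
have dis : B2 `&` ~` B1 = B2.
  apply/setIidPl => w wz wy; have := enorm_dist w y z.
  rewrite [enorm (y - w)]enorm_distC -/d.
  by move: wz wy; rewrite /B1 /B2 /eball /= /s; lra.
have B12 : (mu (B1 `|` B2) = mu B1 + mu B2)%E.
  have := mball y (B1 `|` B2); rewrite -/B1.
  rewrite setIUl setIid (setIC B2) setIUl.
  rewrite (_ : B1 `|` (B1 `&` B2) = B1); last by apply: setUidl; exact: subIsetl.
  by rewrite setICr set0U dis.
(* Inclusion-exclusion, from two uses of Carathéodory measurability. *)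
have E12 : (mu (E1 `|` E2) + mu (E2 `&` E1) = mu E1 + mu E2)%E.
  have := mball (u y) (E1 `|` E2); rewrite -/E1 => ->.
  rewrite (_ : (E1 `|` E2) `&` E1 = E1); last by apply: setIidr; exact: subsetUl.
  rewrite setIUl setICr set0U -addeA; congr (_ + _)%E.
  by rewrite addeC -[in RHS]/E2 (mball (u y) E2).
have E0 : (0 < mu (E2 `&` E1))%E.
  apply: (@open_measure_gt0 _ (2^-1 *: (u y + u z))).
    by apply: openI; exact: eball_open.
  have h1 : 2^-1 *: (u y + u z) - u y = 2^-1 *: (u z - u y).
    by apply/rowP => i; rewrite !mxE; field.
  have h2 : 2^-1 *: (u y + u z) - u z = 2^-1 *: (u y - u z).
    by apply/rowP => i; rewrite !mxE; field.
  split; rewrite /E1 /E2 /eball /= ?h1 ?h2 enormZ ger0_norm//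
    ?[enorm (u z - _)]enorm_distC.
    by rewrite -/d' /s; lra.
  by rewrite -/d' /s; lra.
have BU : B1 `|` B2 `<=` U by rewrite subUset; split; exact: ball_U.
have : (mu (B1 `|` B2) <= mu (E1 `|` E2))%E.
  apply: le_trans (nonexpansive_measure_preserving BU _) _.
    by apply: caratheodory_measurable_setU; exact: mball.
  apply: le_lebesgue_outer; rewrite image_setU; apply: setUSS; exact: ball_u.
have E12fin : mu (E1 `|` E2) \is a fin_num.
  rewrite ge0_fin_numE ?lebesgue_outer_ge0//.
  apply: le_lt_trans (outer_measureU2 _ _ _) _.
  rewrite /= /E1 /E2 (eball_shift (u y) y) (eball_shift (u z) z) -B12.
  apply: le_lt_trans (le_lebesgue_outer BU) _.
  by rewrite -ge0_fin_numE ?lebesgue_outer_ge0.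
(* All four balls have equal measure, so the overlap of positive measure would have to fit inside a
   finite measure without increasing it. *)
rewrite B12 /B1 /B2 (eball_shift y (u y)) (eball_shift z (u z)) -/E1 -/E2 -E12.
by rewrite leNgt lteDl// E0.
Qed.

End LocalIsometry.

(** * From local isometry to one affine formula on the closure *)

Lemma locally_affine_affine (R : realType) (n : nat) (U : set 'rV[R]_n.+1)
    (u : 'rV[R]_n.+1 -> 'rV[R]_n.+1) : connected U ->
  (forall x, U x -> exists2 r, 0 < r &
    forall y z, `|y - x| < r -> `|z - x| < r -> enorm (u y - u z) = enorm (y - z)) ->
  U !=set0 -> exists (M : 'M[R]_n.+1) c, orthogonal_mx M /\
    forall x, U x -> u x = x *m M + c.
Proof.
move=> cU iso [x0 Ux0].
have loc x : U x -> exists2 r, 0 < r & exists (M : 'M[R]_n.+1) c,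
    orthogonal_mx M /\ forall y, `|y - x| < r -> u y = y *m M + c.
  by move=> /iso[r r0 ur]; exists r => //; exact: isometry_affine.
have [r0 r00 [M [c [orth h0]]]] := loc _ Ux0; exists M, c; split => //.
(* The points near which the formula found at [x0] holds; connectedness makes this all of [U] once
   [O] is open and relatively closed. *)
pose O := [set x | exists2 r, 0 < r & forall y, `|y - x| < r -> u y = y *m M + c].
have oO : open O.
  apply: open_norm => x [r rp hr]; exists (r / 2); first by rewrite divr_gt0.
  move=> y yx; exists (r / 2); first by rewrite divr_gt0.
  by move=> z zy; apply: hr; have := ler_distD y z x; lra.
suff UO : U `&` O = U.
  move=> x; rewrite -UO => -[_ [r rp hr]]; apply: hr.
  by rewrite subrr normr0.
apply: cU.
- by exists x0; split => //; exists r0.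
- by exists O.
(* Near a limit point [x] in [U], the affine formula at [x] and the one from [x0] agree on a small
   ball about some [y] in [O], hence coincide by [affine_unique]. *)
- exists (closure (U `&` O)); first exact: closed_closure.
  apply/seteqP; split => x; first by move=> [Ux Ox]; split => //; exact: subset_closure.
  move=> [Ux clx]; split => //; have [r rp [M' [c' [_ hr]]]] := loc _ Ux.
  have [y [[_ [r' r'0 hr']] yx]] : (U `&` O) `&` [set y | `|y - x| < r] !=set0.
    apply: clx; apply/nbhs_ballP; exists r => //= y.
    by rewrite -ball_normE/= distrC.
  have d0 : 0 < Num.min r' (r - `|y - x|) by rewrite lt_min r'0 subr_gt0.
  have [MM cc] : M = M' /\ c = c'.
    apply: (affine_unique d0 (x := y)) => z; rewrite lt_min => /andP[zr' zr].
    rewrite -hr'// hr//; have := ler_distD y z x; move: zr; lra.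
  by exists r => //; rewrite MM cc.
Qed.

(** Passage from the sup norm to the Euclidean norm; the absolute value of [k] is taken because the
    given constant may be negative. *)
Lemma locally_lipschitz_enorm (R : realType) (n : nat) (A : set 'rV[R]_n.+1)
    (u : 'rV[R]_n.+1 -> 'rV[R]_n.+1) x : locally_lipschitz_on A u -> A x ->
  exists2 r, 0 < r & exists2 K, 0 <= K & forall y z, A y -> A z ->
    `|y - x| < r -> `|z - x| < r -> enorm (u y - u z) <= K * enorm (y - z).
Proof.
move=> lip /lip[r [r0 [k hk]]]; exists r => //.
exists (n.+1%:R * `|k|); first by rewrite mulr_ge0.
move=> y z Ay Az yr zr; apply: le_trans (enorm_le_norm _) _.
rewrite -mulrA ler_wpM2l//; apply: le_trans (hk _ _ Ay Az yr zr) _.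
apply: le_trans (ler_wpM2r (normr_ge0 _) (ler_norm k)) _.
by rewrite ler_wpM2l// norm_le_enorm.
Qed.

Lemma locally_nonexpansive (R : realType) (n : nat) (U Z : set 'rV[R]_n.+1)
    (u : 'rV[R]_n.+1 -> 'rV[R]_n.+1) x :
  open U -> locally_lipschitz_on U u -> lebesgue_null Z ->
  (forall y, U y -> ~ Z y -> differentiable u y /\ orthogonal_mx (jacobian u y)) ->
  U x -> exists2 r, 0 < r & nonexpansive_on [set y | `|y - x| < r] u.
Proof.
move=> oU lip Z0 dZ Ux.
have [r1 r10 r1U] := open_ball_norm oU Ux.
have [r2 r20 [K K0 hK]] := locally_lipschitz_enorm lip Ux.
have r0 : 0 < Num.min r1 r2 by rewrite lt_min r10.
exists (Num.min r1 r2) => // y z yr zr.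
apply: (ball_nonexpansive K0 _ Z0 _ zr yr) => [w w'|w].
  rewrite !lt_min => /andP[/r1U Uw wr] /andP[/r1U Uw' wr'].
  exact: hK.
by rewrite lt_min => /andP[/r1U Uw _]; exact: dZ.
Qed.

Lemma affine_on_closure (R : realType) (n : nat) (U : set 'rV[R]_n.+1)
    (u : 'rV[R]_n.+1 -> 'rV[R]_n.+1) (M : 'M[R]_n.+1) c :
  locally_lipschitz_on (closure U) u -> orthogonal_mx M ->
  (forall x, U x -> u x = x *m M + c) ->
  forall x, closure U x -> u x = x *m M + c.
Proof.
move=> lip orth uU x Ux; apply/eqP; rewrite -subr_eq0; apply/eqP/enorm_eq0.
apply/eqP; rewrite eq_le enorm_ge0 andbT.
have [r r0 [K K0 hK]] := locally_lipschitz_enorm lip Ux.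
apply/ler_addgt0Pr => e e0; rewrite add0r.
(* The error at [x] is compared with a nearby [y] in [U]: [K] comes from [u], 1 from the orthogonal
   matrix, and [n.+1] from the change of norm. *)
pose q : R := (K + 1) * n.+1%:R; have q0 : 0 <= q by rewrite mulr_ge0// addr_ge0.
have d0 : 0 < Num.min r (e / (q + 1)) by rewrite lt_min r0 divr_gt0// ltr_wpDl.
have [y [Uy]] : U `&` [set y | `|y - x| < Num.min r (e / (q + 1))] !=set0.
  apply: Ux; apply/nbhs_ballP; exists (Num.min r (e / (q + 1))) => //= y.
  by rewrite -ball_normE/= distrC.
rewrite /= lt_min ltr_pdivlMr ?ltr_wpDl// => /andP[yr ye].
apply: le_trans (enorm_dist (u y) _ _) _.
have -> : u y - (x *m M + c) = (y - x) *m M.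
  by rewrite (uU _ Uy) mulmxBl opprD addrACA subrr addr0.
rewrite enorm_orthogonal//.
have xr : `|x - x| < r by rewrite subrr normr0.
have := hK _ _ Ux (subset_closure Uy) xr yr; rewrite [enorm (x - y)]enorm_distC.
have : (K + 1) * enorm (y - x) <= q * `|y - x|.
  by rewrite /q -mulrA ler_wpM2l ?addr_ge0// enorm_le_norm.
by have := normr_ge0 (y - x); move: ye; rewrite mulrDr mulr1; nra.
Qed.

Unset Implicit Arguments.

Theorem theorem3p8 (R : realType) (N : nat) (U : set 'rV[R]_N)
    (u : 'rV[R]_N -> 'rV[R]_N) :
  open U -> connected U -> bounded_set_rV U ->
  {within closure U, continuous u} ->
  locally_lipschitz_on (closure U) u ->
  open_map_on U u ->
  lebesgue_outer U = lebesgue_outer (u @` U) ->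
  u @` boundary U `<=` boundary (u @` U) ->
  (exists Z : set 'rV[R]_N, lebesgue_null Z /\
     forall x, U x -> ~ Z x -> differentiable u x /\ orthogonal_mx (jacobian u x)) ->
  affine_on (closure U) u.
Proof.
case: N U u => [|n] U u oU cU [B UB] _ lip _ muU _ [Z [Z0 dZ]].
  (* In dimension 0 there is only one vector. *)
  by exists 0, 0 => x _; apply/rowP => -[].
have [U0|/set0P Une] := eqVneq U set0.
  by exists 0, 0 => x; rewrite U0 closure0.
have lipU : locally_lipschitz_on U u.
  move=> x Ux; have [r [r0 [k hk]]] := lip x (subset_closure Ux).
  by exists r; split => //; exists k => y z Uy Uz; apply: hk; exact: subset_closure.
have loc x : U x -> exists2 r, 0 < r & nonexpansive_on [set y | `|y - x| < r] u.
  exact: (locally_nonexpansive oU lipU Z0 dZ).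
have Ufin : lebesgue_outer U \is a fin_num.
  rewrite ge0_fin_numE ?lebesgue_outer_ge0//.
  (* Boxes exclude their upper faces, hence the corner [B + 1]. *)
  apply: (@le_lt_trans _ _ (lebesgue_outer (box (const_mx (- B)) (const_mx (B + 1))))).
    apply: le_lebesgue_outer => x /UB xB i; rewrite !mxE.
    have := le_trans (coord_le_norm x i) xB; rewrite ler_norml => /andP[-> ?].
    by rewrite /= ltr_pwDr.
  by rewrite lebesgue_outer_box ltry.
have [M [c [orth uU]]] :=
  locally_affine_affine cU (locally_isometric oU Ufin muU loc) Une.
by exists M, c; exact: affine_on_closure.
Qed.
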